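(* (i) Let $S$ be a semigroup of $I$-type generated by $X=\{x_1,\ldots,x_n\}$, with $I$-structure $v:\mathcal{U}\to S$, and let $x_{a,i}\in X$ ($a\in\mathcal{U}$, $1\le i\le n$) be the associated elements. Define $r:X^2\to X^2$ by $$r(x_{u_i,j}\,x_{1,i})=x_{u_j,i}\,x_{1,j}\qquad (1\le i,j\le n).$$ Then $r$ satisfies: 1. $r^2=\mathrm{id}_{X^2}$; 2. $r_1r_2r_1=r_2r_1r_2$ as maps $X^3\to X^3$ (set-theoretic Yang-Baxter equation); 3. given $a,b\in\{1,\ldots,n\}$ there exist unique $c,d\in\{1,\ldots,n\}$ such that $r(x_cx_a)=x_dx_b$; furthermore, if $a=b$ then $c=d$. (ii) Conversely, if $X=\{x_1,\ldots,x_n\}$ is a set of $n$ elements and $r:X^2\to X^2$ is a map satisfying 1., 2. and 3., then the semigroup $S=\langle X;\ x_ix_j=r(x_ix_j)\ (1\le i,j\le n)\rangle$ is of $I$-type.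
   Context: Semigroups have a unit, and $\langle X;R\rangle$ denotes the semigroup with unit presented by generators $X$ and relations $R$. $\mathcal{U}$ is the free commutative multiplicative semigroup (with unit) generated by $u_1,\ldots,u_n$. A semigroup $S$ generated by $X=\{x_1,\ldots,x_n\}$ is of (left) $I$-type if there is a bijection $v:\mathcal{U}\to S$ (called an $I$-structure) such that $v(1)=1$ and, for all $a\in\mathcal{U}$, $$\{v(u_1a),\ldots,v(u_na)\}=\{x_1v(a),\ldots,x_nv(a)\}.$$ Given an $I$-structure $v$, for every $a\in\mathcal{U}$ and $i\in\{1,\ldots,n\}$ there is a unique $x_{a,i}\in X$ with $x_{a,i}v(a)=v(au_i)$, and $\{x_{a,i}\mid i=1,\ldots,n\}=X$. (Hence every element of $X^2$ is uniquely of the form $x_{u_i,j}x_{1,i}$.) Elements of $X^m$ are written as words. The map $r_i:X^m\to X^m$ is $\mathrm{id}_{X^{i-1}}\times r\times\mathrm{id}_{X^{m-i-1}}$. *)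

(* Defs.v *)
From HB Require Import structures.
From mathcomp Require Import all_boot.
From mathcomp Require Import boolp classical_sets.
From mathcomp.multinomials Require Import monalg.

Set Implicit Arguments.
Unset Strict Implicit.
Unset Printing Implicit Defensive.

(* Semigroups with unit are [monoidType]s.  The free commutative semigroup
   with unit on u_1, ..., u_n is [{cmonom 'I_n}] (written multiplicatively),
   with [ucm i] the i-th generator, [mone] the unit and [mmul] the product. *)

Section IType.
Variables (n : nat) (S : monoidType).

Definition generated_by (x : 'I_n -> S) : Prop :=
  forall s : S, exists w : seq 'I_n, s = (\prod_(i <- w) x i)%g.

Definition I_structure (x : 'I_n -> S) (v : {cmonom 'I_n} -> S) : Prop :=
  [/\ bijective v,
      v mone = 1%g &
      forall a : {cmonom 'I_n},
        range (fun i : 'I_n => v (mmul (ucm i) a))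
        = range (fun i : 'I_n => (x i * v a)%g)].

Definition of_I_type (x : 'I_n -> S) : Prop :=
  generated_by x /\ exists v : {cmonom 'I_n} -> S, I_structure x v.

(* [xx a i] is the element x_{a,i} of the generating set X. *)
Definition associated_elements (X : set S) (v : {cmonom 'I_n} -> S)
    (xx : {cmonom 'I_n} -> 'I_n -> X) : Prop :=
  forall (a : {cmonom 'I_n}) (i : 'I_n),
    (\val (xx a i) * v a)%g = v (mmul a (ucm i)).

End IType.

Section Conditions.
Variables (X : Type) (r : X * X -> X * X).

(* The maps r_1 = r x id and r_2 = id x r on X^3; a word yz of X^2 is the
   pair (y, z), and a word of X^3 is a triple. *)
Definition r1 (w : X * X * X) : X * X * X :=
  let: (y, z, t) := w in ((r (y, z)).1, (r (y, z)).2, t).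

Definition r2 (w : X * X * X) : X * X * X :=
  let: (y, z, t) := w in (y, (r (z, t)).1, (r (z, t)).2).

Definition r_involutive : Prop := forall w : X * X, r (r w) = w.

Definition r_yang_baxter : Prop :=
  forall w : X * X * X, r1 (r2 (r1 w)) = r2 (r1 (r2 w)).

Definition r_right_condition (n : nat) (x : 'I_n -> X) : Prop :=
  (forall a b : 'I_n,
     exists! cd : 'I_n * 'I_n, r (x cd.1, x a) = (x cd.2, x b)) /\
  (forall a c d : 'I_n, r (x c, x a) = (x d, x a) -> c = d).

End Conditions.

Section Presentation.
Variables (X : choiceType) (R : seq X -> seq X -> Prop).

Inductive congruence_gen : seq X -> seq X -> Prop :=
| cong_base w w' : R w w' -> congruence_gen w w'
| cong_refl w : congruence_gen w w
| cong_sym w w' : congruence_gen w w' -> congruence_gen w' w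
| cong_trans w2 w1 w3 :
    congruence_gen w1 w2 -> congruence_gen w2 w3 -> congruence_gen w1 w3
| cong_cat w1 w1' w2 w2' :
    congruence_gen w1 w1' -> congruence_gen w2 w2' ->
    congruence_gen (w1 ++ w2) (w1' ++ w2').

Definition congb (w w' : seq X) : bool := `[< congruence_gen w w' >].

Lemma congb_refl : reflexive congb.
Proof. by move=> w; apply/asboolP; apply: cong_refl. Qed.

Lemma congb_sym : symmetric congb.
Proof. by move=> w w'; apply/asboolP/asboolP; apply: cong_sym. Qed.

Lemma congb_trans : transitive congb.
Proof.
by move=> w2 w1 w3 /asboolP h /asboolP h'; apply/asboolP; apply: cong_trans h'.
Qed.

Canonical congb_equiv := EquivRel congb congb_refl congb_sym congb_trans.

Local Open Scope quotient_scope.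

(* The semigroup with unit <X; R>. *)
Definition presented : Type := {eq_quot congb_equiv}.

HB.instance Definition _ := Choice.on presented.
HB.instance Definition _ := EqQuotient.on presented.

Definition pres_class (w : seq X) : presented := \pi_presented w.
Definition pres_one : presented := pres_class [::].
Definition pres_mul (s t : presented) : presented :=
  pres_class (repr s ++ repr t).

Lemma pres_classP w w' :
  pres_class w = pres_class w' <-> congruence_gen w w'.
Proof.
split=> [/eqmodP/asboolP //|h].
by apply/eqmodP/asboolP.
Qed.

Lemma pres_mulE w w' :
  pres_mul (pres_class w) (pres_class w') = pres_class (w ++ w').
Proof.
by apply/pres_classP; apply: cong_cat; apply/pres_classP;
   rewrite /pres_class reprK.
Qed.

Lemma pres_reprK s : pres_class (repr s) = s.
Proof. exact: reprK. Qed.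

Lemma pres_mulA : associative pres_mul.
Proof.
move=> s t u; rewrite -(pres_reprK s) -(pres_reprK t) -(pres_reprK u).
by rewrite !pres_mulE catA.
Qed.

Lemma pres_mul1 : left_id pres_one pres_mul.
Proof. by move=> s; rewrite -(pres_reprK s) pres_mulE. Qed.

Lemma pres_mulr1 : right_id pres_one pres_mul.
Proof. by move=> s; rewrite -(pres_reprK s) pres_mulE cats0. Qed.

HB.instance Definition _ :=
  isMonoid.Build presented pres_mulA pres_mul1 pres_mulr1.

Definition pres_gen (y : X) : presented := pres_class [:: y].

End Presentation.

(* The defining relations x_i x_j = r(x_i x_j). *)
Definition r_relations (X : Type) (n : nat) (x : 'I_n -> X)
    (r : X * X -> X * X) (w w' : seq X) : Prop :=
  exists i j : 'I_n,
    w = [:: x i; x j] /\ w' = [:: (r (x i, x j)).1; (r (x i, x j)).2].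

(* Main.v *)
Require Import Defs.
From mathcomp Require Import all_boot.
From mathcomp Require Import boolp classical_sets.
From mathcomp Require Import finmap.
From mathcomp.multinomials Require Import monalg.

Set Implicit Arguments.
Unset Strict Implicit.
Unset Printing Implicit Defensive.

(** An I-structure is a way of walking through S that is indexed by the free
    commutative monoid U: from v(a), the step in direction i is multiplication
    on the left by x_{a,i}.  Two steps i then j from v(a) spell the word
    x_{a u_i,j} x_{a,i}, and for each a every word of length 2 arises once in
    this way ([coded_pair_bij]).

    From S to r.  The map r exchanges the two steps of a walk that starts at
    v(1).  The point is that it then exchanges the two steps of a walk starting
    anywhere ([coded_swap]): since U is commutative, the exchanged walk
    ends at the same element, so both words have the same product in S after
    multiplication by v(a), and v(a) may be cancelled by counting
    ([pair_prod_cancel]).  Hence, in the coordinates (i, j, k) of walks of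
    length 3, r_1 and r_2 are the two adjacent transpositions of coordinates,
    and the Yang-Baxter equation is the braid relation of the symmetric group.

    From r to S.  Condition 3 says that each pair a, b completes uniquely to a
    relation (star a b) a = (star b a) b, and the Yang-Baxter equation becomes
    the law
      star (star a b) (star a c) = star (star b a) (star b c)
    ([star_cycle_law]).  A walk at a point is described by the bijection f
    sending a direction i to the letter f i; after the step i, this bijection
    becomes j |-> star (f i) (f j), and the law says that the steps i and j
    commute.  Reading off the letters of a walk gives a bijection [encode f]
    between words in the directions and words in X.  An exchange of two
    consecutive directions corresponds exactly to one application of r, so two
    walks spell the same element of S if and only if they are permutations of
    each other ([encode_congr], [congr_encode]), that is, if and only if they
    give the same element of U. *)

(** * Words in the free commutative monoid *)

Section FreeCommutative.
Variable I : choiceType.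
Implicit Types (a b c : {cmonom I}) (i j k l : I).

Definition monomial_of_word (w : seq I) : {cmonom I} :=
  \big[mmul/mone]_(i <- w) ucm i.

Lemma mmul_injr a : injective (mmul a).
Proof.
move=> b c abc; apply/eqP/cmP => i; apply/eqP.
have /eqP := congr1 (fun m : {cmonom I} => m i) abc.
by rewrite !mulcmE eqn_add2l.
Qed.

Lemma ucm_inj : injective (@ucm I).
Proof.
move=> i j uij; have := congr1 (fun m : {cmonom I} => m i) uij.
by rewrite !ucmE eqxx; case: eqP.
Qed.

Lemma monomial_of_wordE w i : monomial_of_word w i = count_mem i w.
Proof.
rewrite /monomial_of_word; elim: w => [|k w IH]; first by rewrite big_nil onecmE.
by rewrite big_cons mulcmE IH ucmE /=.
Qed.

Lemma monomial_of_word_eq w w' :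
  monomial_of_word w = monomial_of_word w' <-> perm_eq w w'.
Proof.
split=> [ww'|/permP ww'].
  by apply/allP => i _ /=; rewrite -!monomial_of_wordE ww'.
by apply/eqP/cmP => i; rewrite !monomial_of_wordE ww'.
Qed.

Lemma ucm_mul2_eq i j k l :
  mmul (ucm i) (ucm j) = mmul (ucm k) (ucm l) ->
  (k = i /\ l = j) \/ (k = j /\ l = i).
Proof.
move=> e.
have /monomial_of_word_eq/perm_mem pe :
    monomial_of_word [:: i; j] = monomial_of_word [:: k; l].
  by rewrite /monomial_of_word !big_cons !big_nil !mulm1.
have := pe k; rewrite !inE eqxx /= => /orP[/eqP ki|/eqP kj]; subst k.
  by left; split=> //; apply/esym/ucm_inj/(mmul_injr e).
by right; split=> //; apply/esym/ucm_inj/(@mmul_injr (ucm j)); rewrite mulmC.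
Qed.

Lemma monomial_of_word_surj a : exists w, monomial_of_word w = a.
Proof.
exists (flatten [seq nseq (a i) i | i <- enum_fset (finsupp a)]).
apply/eqP/cmP => i; rewrite monomial_of_wordE count_flatten sumnE !big_map.
have [ai|/fsfun_dflt ai] := boolP (i \in finsupp a).
  rewrite (bigD1_seq i) ?fset_uniq //= count_nseq /= eqxx mul1n big1 ?addn0 //.
  by move=> j /negPf ji; rewrite count_nseq /= ji.
rewrite ai big1_seq // => j _; rewrite count_nseq /=.
by case: eqP => [->|_] //; rewrite mul1n ai.
Qed.

End FreeCommutative.

(** * From a semigroup of I-type to the map r *)

Lemma pigeonhole_inj (T U : eqType) (D : seq T) (f g : T -> U) :
  uniq D -> {in D &, injective g} -> {subset map g D <= map f D} ->
  {in D &, injective f}.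
Proof.
move=> uD injg sub.
have uf : uniq (map f D).
  by apply: leq_size_uniq sub _; rewrite ?map_inj_in_uniq // !size_map.
elim: D uf {uD injg sub} => //= y s IH /andP[fy us] b c.
rewrite !inE => /orP[/eqP->|bs] /orP[/eqP->|cs] fbc //; last exact: IH.
  by rewrite fbc map_f in fy.
by rewrite -fbc map_f in fy.
Qed.

Section FromIType.
Variables (n : nat) (S : monoidType) (X : set S) (x : 'I_n -> X).
Variables (v : {cmonom 'I_n} -> S) (xx : {cmonom 'I_n} -> 'I_n -> X).
Hypothesis x_surj : forall y : X, exists i : 'I_n, x i = y.
Hypothesis v_inj : injective v.
Hypothesis v1 : v mone = 1%g.
Hypothesis xxE : associated_elements v xx.

Lemma associated_inj a : injective (xx a).
Proof.
by move=> i j xij; apply/ucm_inj/(@mmul_injr _ a)/v_inj; rewrite -!xxE xij.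
Qed.

(** X has at most n elements, being enumerated by x, so the injection of the n
    directions into X is onto. *)
Lemma associated_surj a y : exists i, xx a i = y.
Proof.
have [g gE] := choice (fun i => x_surj (xx a i)).
have /injF_bij[h _ gh] : injective g.
  by move=> i j gij; apply: (@associated_inj a); rewrite -!gE gij.
by have [k <-] := x_surj y; exists (h k); rewrite -gE gh.
Qed.

Lemma x_inj : injective x.
Proof.
have [g gE] := choice (fun i => x_surj (xx mone i)).
have /injF_bij[h _ gh] : injective g.
  by move=> i j gij; apply: (@associated_inj mone); rewrite -!gE gij.
move=> i j; rewrite -(gh i) -(gh j) !gE => /associated_inj -> //.
Qed.

(** The word spelt by the steps p.1 then p.2 from v(a), the later step being
    the letter on the left. *)
Definition coded_pair a (p : 'I_n * 'I_n) : X * X :=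
  (xx (mmul a (ucm p.1)) p.2, xx a p.1).

Lemma coded_pair_bij a : bijective (coded_pair a).
Proof.
have surj w : exists p, coded_pair a p = w.
  case: w => y z; have [i <-] := associated_surj a z.
  by have [j <-] := associated_surj (mmul a (ucm i)) y; exists (i, j).
have [d dK] := choice surj; exists d => // -[i j].
have : coded_pair a (d (coded_pair a (i, j))) = coded_pair a (i, j) by rewrite dK.
case: (d _) => k l [] /= + /associated_inj ki; rewrite ki.
by move=> /associated_inj ->.
Qed.

Definition pair_prod (w : X * X) : S := (\val w.1 * \val w.2)%g.

Lemma pair_prod_coded a p :
  (pair_prod (coded_pair a p) * v a)%g = v (mmul a (mmul (ucm p.1) (ucm p.2))).
Proof. by rewrite /pair_prod -mulgA !xxE mulmA. Qed.

Lemma pair_prod_coded1 p :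
  pair_prod (coded_pair mone p) = v (mmul (ucm p.1) (ucm p.2)).
Proof. by rewrite -[LHS]mulg1 -v1 pair_prod_coded mul1m. Qed.

(** Right multiplication by v(a) maps the products of two generators, which are
    the values of v in degree 2, onto the values of v on a times degree 2, since
    every element of the latter kind is spelt by a word of length 2 from v(a).
    Both sets have as many elements as there are monomials of degree 2, so
    this surjection is injective. *)
Lemma pair_prod_cancel a w w' :
  (pair_prod w * v a)%g = (pair_prod w' * v a)%g -> pair_prod w = pair_prod w'.
Proof.
pose D := undup [seq mmul (ucm p.1) (ucm p.2) | p <- enum {: 'I_n * 'I_n}].
have inD p : mmul (ucm p.1) (ucm p.2) \in D.
  by rewrite mem_undup; apply: map_f; rewrite mem_enum.
have [d _ dK] := coded_pair_bij mone.
have wE u : pair_prod u = v (mmul (ucm (d u).1) (ucm (d u).2)).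
  by rewrite -pair_prod_coded1 dK.
rewrite !wE => ww'; congr v.
apply: (@pigeonhole_inj _ _ D (fun b => v b * v a)%g (fun b => v (mmul a b)))
  ww' => //; first exact: undup_uniq.
  by move=> b c _ _ /v_inj/mmul_injr.
move=> s /mapP[b]; rewrite mem_undup => /mapP[p _ ->] ->.
rewrite -pair_prod_coded wE.
by apply: (map_f (fun b => v b * v a)%g).
Qed.

Definition flip_pair (p : 'I_n * 'I_n) := (p.2, p.1).

Lemma exists_unique_coded_swap :
  exists r : X * X -> X * X,
    unique (fun r' : X * X -> X * X => forall i j : 'I_n,
      r' (xx (ucm i) j, xx mone i) = (xx (ucm j) i, xx mone j)) r.
Proof.
have [d dK Kd] := coded_pair_bij mone.
have E p : coded_pair mone p = (xx (ucm p.1) p.2, xx mone p.1).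
  by rewrite /coded_pair mul1m.
exists (fun w => coded_pair mone (flip_pair (d w))); split=> [i j|r' r'E].
  by rewrite -(E (i, j)) dK E.
by apply/funext => w; rewrite -{2}(Kd w) !E r'E.
Qed.

Section TheMap.
Variable r : X * X -> X * X.
Hypothesis rE : forall i j : 'I_n,
  r (xx (ucm i) j, xx mone i) = (xx (ucm j) i, xx mone j).

Lemma coded_swap1 p : r (coded_pair mone p) = coded_pair mone (flip_pair p).
Proof. by rewrite /coded_pair !mul1m rE. Qed.

Lemma coded_swap_involutive : r_involutive r.
Proof.
move=> w; have [d _ dK] := coded_pair_bij mone.
by rewrite -(dK w) !coded_swap1; case: (d w).
Qed.

Lemma pair_prod_coded_swap w : pair_prod (r w) = pair_prod w.
Proof.
have [d _ dK] := coded_pair_bij mone.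
by rewrite -(dK w) coded_swap1 !pair_prod_coded1 mulmC.
Qed.

(** The codings of p and of the flipped p have the same product, and no other
    word of length 2 shares it.  So r can only fail
    to exchange them by fixing the first one, and a word fixed by r is, seen
    from v(1), a repeated step, hence alone with its product. *)
Lemma coded_swap a p : r (coded_pair a p) = coded_pair a (flip_pair p).
Proof.
have [d _ dK] := coded_pair_bij mone.
have [e _ Ke] := coded_pair_bij a.
set w := coded_pair a p; set w' := coded_pair a (flip_pair p).
have ww' : pair_prod w = pair_prod w'.
  by apply: (@pair_prod_cancel a); rewrite !pair_prod_coded [X in mmul a X]mulmC.
have : mmul (ucm p.1) (ucm p.2) = mmul (ucm (e (r w)).1) (ucm (e (r w)).2).
  apply/(@mmul_injr _ a)/v_inj; rewrite -!pair_prod_coded -/w Ke.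
  by rewrite pair_prod_coded_swap.
move=> /ucm_mul2_eq[] [e1 e2]; last first.
  by rewrite -(Ke (r w)); congr coded_pair; apply/eqP/andP; rewrite e1 e2.
have rw : r w = w.
  by rewrite -(Ke (r w)); congr coded_pair; apply/eqP/andP; rewrite e1 e2.
(* In the coding from the unit, a fixed word is a repeated step. *)
have dd : (d w).1 = (d w).2.
  have := coded_swap1 (d w); rewrite dK rw -{1}(dK w).
  by move=> /(bij_inj (coded_pair_bij mone)); case: (d w) => ? ? [].
rewrite rw; have := ww'; rewrite -(dK w) -(dK w') !pair_prod_coded1 => /v_inj.
move=> /ucm_mul2_eq; rewrite -dd => dd'.
by congr coded_pair; case: (d w') dd' => ? ? /=; case: (d w) dd => ? ? /= ->; case=> [] [-> ->].
Qed.

Lemma coded_swap_yang_baxter : r_yang_baxter r.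
Proof.
(* The word of the walk i, j, k from the unit: r_1 exchanges its last two
   steps, r_2 its first two. *)
pose W i j k := (xx (mmul (ucm i) (ucm j)) k, xx (ucm i) j, xx mone i).
have W1 i j k : r1 r (W i j k) = W i k j.
  rewrite /r1 /W.
  by have /= -> := coded_swap (ucm i) (j, k).
have W2 i j k : r2 r (W i j k) = W j i k.
  by rewrite /r2 /W rE /= [mmul (ucm j) _]mulmC.
move=> [[y z] t].
have [i <-] := associated_surj mone t.
have [j <-] := associated_surj (ucm i) z.
have [k <-] := associated_surj (mmul (ucm i) (ucm j)) y.
by rewrite -/(W i j k) !(W1, W2).
Qed.

(** If xx_1 i = x_a and xx_1 j = x_b, then r exchanges the steps i and j, so x_c
    and x_d are forced to be the letters of the step j after i and of i after
    j. *)
Lemma coded_swap_right_condition : r_right_condition r x.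
Proof.
split=> [a b|a c d].
  have [i ai] := associated_surj mone (x a).
  have [j bj] := associated_surj mone (x b).
  have [c cE] := x_surj (xx (ucm i) j).
  have [d dE] := x_surj (xx (ucm j) i).
  exists (c, d); split=> [|[c' d'] /=]; first by rewrite /= cE dE -ai -bj rE.
  have [k ck] := associated_surj (ucm i) (x c').
  rewrite -ck -ai -bj rE => -[+ /associated_inj jk].
  by rewrite jk -dE => /x_inj ->; rewrite jk in ck; congr pair; apply: x_inj; rewrite cE.
have [i ai] := associated_surj mone (x a).
have [k ck] := associated_surj (ucm i) (x c).
rewrite -ck -ai rE => -[+ /associated_inj ki].
by rewrite ki in ck *; rewrite ck => /x_inj.
Qed.

End TheMap.
End FromIType.

(** * From the law of star to an I-structure *)

Lemma perm_eq_swap_ind (T : eqType) (P : seq T -> Prop) :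
  (forall p s i j, P (p ++ i :: j :: s) -> P (p ++ j :: i :: s)) ->
  forall s s', perm_eq s s' -> P s -> P s'.
Proof.
move=> swapP; apply: catCA_perm_ind => s1 s2 s3.
suff moveP p : P (p ++ s1 ++ s2 ++ s3) -> P (p ++ s2 ++ s1 ++ s3).
  exact: (moveP [::]).
elim: s1 s2 p => [|i s1 IH] s2 p //= Ps.
have {}Ps : P (p ++ i :: s2 ++ s1 ++ s3).
  by rewrite -cat_rcons; apply: IH; rewrite cat_rcons.
elim: s2 p Ps {IH} => [|j s2 IH] p //= Ps.
by rewrite -cat_rcons; apply: IH; rewrite cat_rcons; apply: swapP.
Qed.

Section CycleSet.
Variables (n : nat) (X : finType) (x : 'I_n -> X) (r : X * X -> X * X).
Hypothesis x_bij : bijective x.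
Variable star : X -> X -> X.
Hypothesis r_star : forall a b, r (star a b, a) = (star b a, b).
Hypothesis star_bij : forall a, bijective (star a).
Hypothesis star_cycle : forall a b c,
  star (star a b) (star a c) = star (star b a) (star b c).

Implicit Types (f : 'I_n -> X) (l : seq 'I_n) (w : seq X).

(** If f i is the letter of the step in direction i, then [shift f i] gives the
    letters of the steps that follow the step i. *)
Definition shift f (i : 'I_n) : 'I_n -> X := fun j => star (f i) (f j).

(** The steps of l are taken from left to right, and multiply on the left; so the
    first step contributes the last letter. *)
Fixpoint encode f l : seq X :=
  if l is i :: l' then rcons (encode (shift f i) l') (f i) else [::].

Lemma shift_bij f i : bijective f -> bijective (shift f i).
Proof. exact: bij_comp (star_bij (f i)). Qed.

Lemma foldl_shift_bij f l : bijective f -> bijective (foldl shift f l).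
Proof. by elim: l f => //= i l IH f fb; apply/IH/shift_bij. Qed.

Lemma shiftC f i j : shift (shift f i) j = shift (shift f j) i.
Proof. by apply/funext => k; apply: star_cycle. Qed.

Lemma shift_perm f l l' : perm_eq l l' -> foldl shift f l = foldl shift f l'.
Proof.
move=> ll'; move: ll' (erefl (foldl shift f l)).
apply: (perm_eq_swap_ind (P := fun s => _ = foldl shift f s)) => p s i j ->.
by rewrite !foldl_cat /= shiftC.
Qed.

Lemma encode_cat f l l' :
  encode f (l ++ l') = encode (foldl shift f l) l' ++ encode f l.
Proof. by elim: l f => [|i l IH] f /=; rewrite ?cats0 // IH rcons_cat. Qed.

Lemma encode_rcons f l i :
  encode f (rcons l i) = foldl shift f l i :: encode f l.
Proof. by rewrite -cats1 encode_cat. Qed.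

Lemma encode_inj f : bijective f -> injective (encode f).
Proof.
move=> + l; elim: l f => [|i l IH] f fb [|j l'] //=.
- by case: (encode _ _).
- by case: (encode _ _).
move=> /rcons_inj[+ /(bij_inj fb) ij]; rewrite ij.
by move=> /(IH _ (shift_bij j fb)) ->.
Qed.

Lemma encode_surj f w : bijective f -> exists l, encode f l = w.
Proof.
elim/last_ind: w f => [|w y IH] f fb; first by exists [::].
have [g _ gK] := fb.
by have [l <-] := IH _ (shift_bij (g y) fb); exists (g y :: l); rewrite /= gK.
Qed.

Local Notation "w ~ w'" := (congruence_gen (r_relations x r) w w')
  (at level 70).

Lemma r_congr y z : [:: y; z] ~ [:: (r (y, z)).1; (r (y, z)).2].
Proof.
have [g _ gK] := x_bij.
by apply: cong_base; exists (g y), (g z); rewrite !gK.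
Qed.

(** An exchange of adjacent steps i, j leaves the letters before and after it
    unchanged, by commutation of the shifts, and replaces the two letters
    in between by their image under r. *)
Lemma encode_congr f l l' : perm_eq l l' -> encode f l ~ encode f l'.
Proof.
move=> ll'; move: ll' (@cong_refl _ (r_relations x r) (encode f l)).
apply: (perm_eq_swap_ind (P := fun s => _ ~ encode f s)) => p s i j.
move=> /cong_trans; apply; rewrite !encode_cat /= -!cats1 -!catA shiftC.
set g := foldl shift f p.
apply: cong_cat; first exact: cong_refl.
rewrite !catA; apply: cong_cat; last exact: cong_refl.
by have := r_congr (shift g i j) (g i); rewrite r_star.
Qed.

(** Induction on the derivation of the congruence, for all starting bijections
    f at once: for a product of words, the walk of the left factor starts where
    that of the right factor stops, and equivalent right factors stop at the
    same bijection by [shift_perm].  Transitivity needs the intermediate word to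
    be spelt by a walk, which is [encode_surj]. *)
Lemma congr_encode f l l' :
  bijective f -> encode f l ~ encode f l' -> perm_eq l l'.
Proof.
move=> fb; move: (erefl (encode f l)) (erefl (encode f l')) => /[swap].
move: {1 3}(encode f l) {1 3}(encode f l') => w w' + + ww'.
elim: ww' f l l' fb => {w w'} [w w' [i [j [-> ->]]]|w|w w' _ IH|w2 w1 w3 _ IH1 _ IH2
  |w1 w1' w2 w2' _ IH1 _ IH2] f l l' fb El' El.
- have [g _ gK] := fb.
  have [h _ hK] := shift_bij (g (x j)) fb.
  have lE : l = [:: g (x j); h (x i)].
    by apply: (encode_inj fb); rewrite -El /= gK hK.
  have l'E : l' = [:: h (x i); g (x j)].
    have hi : star (f (g (x j))) (f (h (x i))) = x i := hK (x i).
    apply: (encode_inj fb); rewrite -El' /= /shift.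
    by have := r_star (f (g (x j))) (f (h (x i))); rewrite hi gK => ->.
  by rewrite lE l'E (perm_catC [:: _] [:: _]).
- by rewrite (encode_inj fb (etrans (esym El) El')).
- by rewrite perm_sym; apply: IH El El'.
- have [m Em] := encode_surj w2 fb.
  by apply: (perm_trans (IH1 f l m _ _ _) (IH2 f m l' _ _ _)).
have [l1 El1] := encode_surj w2 fb.
have [l1' El1'] := encode_surj w2' fb.
have p1 : perm_eq l1 l1' by apply: (IH2 f).
have hb := foldl_shift_bij l1 fb.
have [l2 El2] := encode_surj w1 hb.
have [l2' El2'] := encode_surj w1' hb.
have -> : l = l1 ++ l2 by apply: (encode_inj fb); rewrite encode_cat El1 El2.
have -> : l' = l1' ++ l2'.
  by apply: (encode_inj fb); rewrite encode_cat -(shift_perm _ p1) El1' El2'.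
by apply: perm_cat p1 (IH1 _ _ _ hb _ _).
Qed.

(** The I-structure sends a monomial to the class of the word spelt by any walk
    from x with this monomial.  Its defining condition holds because the letter
    of one more step i is f i, for the bijection f reached by the walk, so that
    all generators occur as i varies. *)
Lemma presented_I_type : of_I_type (fun i => pres_gen (r_relations x r) (x i)).
Proof.
have classM w w' : pres_class (r_relations x r) (w ++ w')
    = (pres_class (r_relations x r) w * pres_class (r_relations x r) w')%g.
  by rewrite -[RHS]/(pres_mul _ _) pres_mulE.
split=> [s|].
  have [g _ gK] := x_bij.
  exists (map g (repr s)); rewrite -{1}(pres_reprK s) big_map.
  elim: (repr s) => [|y w IH]; first by rewrite big_nil.
  by rewrite big_cons -IH -cat1s classM gK.
have [word wordK] := choice (@monomial_of_word_surj 'I_n).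
have wordP l : perm_eq (word (monomial_of_word l)) l.
  by apply/monomial_of_word_eq.
exists (fun a => pres_class (r_relations x r) (encode x (word a))); split.
- have surj s : exists a, pres_class (r_relations x r) (encode x (word a)) = s.
    have [l El] := encode_surj (repr s) x_bij.
    exists (monomial_of_word l); rewrite -(pres_reprK s) -El.
    exact/pres_classP/encode_congr/wordP.
  have [h hK] := choice surj; exists h => // a.
  have /pres_classP/(congr_encode x_bij)/monomial_of_word_eq := hK
    (pres_class (r_relations x r) (encode x (word a))).
  by rewrite !wordK.
- by have /perm_nilP := wordP [::]; rewrite /monomial_of_word big_nil => ->.
move=> a; pose f := foldl shift x (word a).
have [g gK Kg] : bijective f := foldl_shift_bij (word a) x_bij.
have [h hK Kh] := x_bij.
have step i : pres_class (r_relations x r) (encode x (word (mmul (ucm i) a)))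
    = (pres_gen (r_relations x r) (f i)
       * pres_class (r_relations x r) (encode x (word a)))%g.
  rewrite /pres_gen -classM cat1s -encode_rcons.
  apply/pres_classP/encode_congr/monomial_of_word_eq.
  by rewrite wordK /monomial_of_word -cats1 big_cat big_seq1 -/(monomial_of_word _)
     wordK mulmC.
apply/seteqP; split=> _ [i _ <-].
  by exists (h (f i)) => //; rewrite Kh step.
by exists (g (x i)) => //; rewrite step Kg.
Qed.

End CycleSet.

(** * The operation star of a solution *)

Lemma right_condition_star (n : nat) (X : Type) (x : 'I_n -> X)
    (r : X * X -> X * X) :
  bijective x -> r_right_condition r x ->
  exists star : X -> X -> X,
    forall a b c, (r (c, a)).2 = b <-> c = star a b.
Proof.
move=> [g gK Kg] [rc _].
have ex (ab : X * X) : exists c0, forall c, (r (c, ab.1)).2 = ab.2 <-> c = c0.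
  have [[c d] /= [rcd uniq_cd]] := rc (g ab.1) (g ab.2).
  rewrite !Kg in rcd uniq_cd; exists (x c) => c'; split=> [rc'|->]; last by rewrite rcd.
  have := uniq_cd (g c', g (r (c', ab.1)).1); rewrite /= !Kg -rc'.
  by rewrite -surjective_pairing => /(_ erefl)[-> _]; rewrite Kg.
have [star starP] := choice ex.
by exists (fun a b => star (a, b)) => a b c; apply: (starP (a, b)).
Qed.

Section StarLaws.
Variables (X : finType) (r : X * X -> X * X) (star : X -> X -> X).
Hypothesis r_inv : r_involutive r.
Hypothesis r_yb : r_yang_baxter r.
Hypothesis starP : forall a b c, (r (c, a)).2 = b <-> c = star a b.

(** If r(c, a) = (d, b) then r(d, b) = (c, a) by involutivity, so d completes b, a
    in the way that c completes a, b. *)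
Lemma r_of_star a b : r (star a b, a) = (star b a, b).
Proof.
have := r_inv (star a b, a); have : (r (star a b, a)).2 = b by apply/starP.
case: (r _) => d b' /= -> rdb; congr pair.
by apply/starP; rewrite rdb.
Qed.

Lemma star_inj a : injective (star a).
Proof. by move=> b c bc; have := r_of_star a b; rewrite bc r_of_star => -[]. Qed.

(** Apply the two sides of the Yang-Baxter equation to the word with letters
    star (star a b) (star a c), star a b, a.  In r_1 r_2 r_1 the first two steps are
    known from [r_of_star] and give the last letter c; in r_2 r_1 r_2 this forces
    the second letter of r(star (star a b) (star a c), star b a) to be star b c,
    which is what characterizes star (star b a) (star b c). *)
Lemma star_cycle_law a b c :
  star (star a b) (star a c) = star (star b a) (star b c).
Proof.
have := r_yb (star (star a b) (star a c), star a b, a).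
rewrite /r1 /r2 /= !r_of_star /= => -[_ _ /esym/starP Qbc].
exact/starP.
Qed.

End StarLaws.

Theorem theorem1p4 :
  (forall (n : nat) (S : monoidType) (X : set S) (x : 'I_n -> X)
     (v : {cmonom 'I_n} -> S) (xx : {cmonom 'I_n} -> 'I_n -> X),
     (forall y : X, exists i : 'I_n, x i = y) ->
     generated_by (fun i : 'I_n => \val (x i)) ->
     I_structure (fun i : 'I_n => \val (x i)) v ->
     associated_elements v xx ->
     exists r : X * X -> X * X,
       (unique (fun r' : X * X -> X * X => forall i j : 'I_n,
          r' (xx (ucm i) j, xx mone i) = (xx (ucm j) i, xx mone j)) r) /\
       [/\ r_involutive r, r_yang_baxter r & r_right_condition r x])
  /\
  (forall (n : nat) (X : finType) (x : 'I_n -> X) (r : X * X -> X * X),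
     bijective x ->
     r_involutive r -> r_yang_baxter r -> r_right_condition r x ->
     of_I_type
       (fun i : 'I_n => pres_gen (r_relations x r) (x i))).
Proof.
split=> [n S X x v xx x_surj _ [/bij_inj v_inj v1 _] xxE
        |n X x r x_bij r_inv r_yb r_right].
  have [r r_unique] := exists_unique_coded_swap x_surj v_inj xxE.
  have rE := r_unique.1; exists r; split=> //; split.
  - exact: (coded_swap_involutive x_surj v_inj xxE rE).
  - exact: (coded_swap_yang_baxter x_surj v_inj v1 xxE rE).
  - exact: (coded_swap_right_condition x_surj v_inj xxE rE).
have [star starP] := right_condition_star x_bij r_right.
apply: (presented_I_type x_bij (star := star)) => [a b|a|a b c].
- exact: r_of_star.
- exact/injF_bij/star_inj.
- exact: star_cycle_law.
Qed.
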